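(* Let $R$ be a noetherian commutative ring and $S$ a multiplicative set of $R$ consisting of non-zero-divisors. Let $\Omega$ be the commutative monoid of finitely generated $R$-submodules of $S^{-1}R$. Then the map $\mathcal{F}:\mathcal{M}\to\Omega$ defined by $\mathcal{F}(M)=\mathrm{Fitt}_R(M)$ is a Fitting invariant.
   Context: $\mathcal M$ is the category of finitely generated $S$-torsion $R$-modules and $\mathcal P=\{P\in\mathcal M\mid\mathrm{pd}_R(P)\le1\}$. $\mathrm{Fitt}_R(M)$ is the initial Fitting ideal: for a presentation $R^b\xrightarrow{h}R^a\to M\to0$, the ideal generated by the $a\times a$ minors of $h$. The monoid structure on $\Omega$ is the product of submodules. A Fitting invariant is a map $\mathcal F$ assigning to each object of $\mathcal M$ an element of a commutative monoid $\Omega$ such that: (i) $\mathcal F(P)\in\Omega^\times$ for $P\in\mathcal P$; (ii) if $0\to M'\to M\to P\to0$ is exact in $\mathcal M$ with $P\in\mathcal P$, then $\mathcal F(M)=\mathcal F(P)\mathcal F(M')$. *)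

(* Defs.v *)
From HB Require Import structures.
From mathcomp Require Import all_boot all_order perm all_algebra.
From mathcomp Require Import boolp classical_sets functions cardinality.
From mathcomp Require Import ring.

Set Implicit Arguments.
Unset Strict Implicit.
Unset Printing Implicit Defensive.

Import GRing.Theory.

Local Open Scope classical_set_scope.
Local Open Scope ring_scope.
Local Open Scope quotient_scope.

(* Rings are taken in [comPzRingType], so that the zero ring is allowed. *)

Section Submodules.
Variables (R : comPzRingType) (V : lmodType R).
Implicit Types (A X : set V).

Definition submodule A : Prop := submod_closed [in A].

Definition span X : set V := smallest submodule X.

Definition fin_gen A : Prop := exists2 X : set V, finite_set X & A = span X.

Lemma submoduleP A :
  submodule A <-> A 0 /\ (forall a u v, A u -> A v -> A (a *: u + v)).
Proof.
split=> -[A0 Al]; split.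
- by move: A0; rewrite !inE.
- by move=> a u v Au Av; have := Al a u v; rewrite !inE; exact.
- by rewrite !inE.
- by move=> a u v; rewrite !inE; exact: Al.
Qed.

Lemma span_submodule X : submodule (span X).
Proof.
apply/submoduleP; split=> [B [/submoduleP[]]//|a u v Xu Xv B BX].
by have [/submoduleP[_ Bl] _] := BX; apply: Bl; [apply: Xu|apply: Xv].
Qed.

Lemma sub_span X : X `<=` span X.
Proof. exact: sub_gen_smallest. Qed.

Lemma span_sub X A : submodule A -> X `<=` A -> span X `<=` A.
Proof. exact: smallest_sub. Qed.

Lemma span_mono X Y : X `<=` Y -> span X `<=` span Y.
Proof.
move=> XY; apply: span_sub; first exact: span_submodule.
exact: subset_trans (@sub_span _).
Qed.

Lemma span_id A : submodule A -> span A = A.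
Proof. exact: smallest_id. Qed.

Lemma span_seqP (s : seq V) x :
  span [set` s] x <-> exists c : 'I_(size s) -> R, x = \sum_i c i *: s`_i.
Proof.
split=> [|[c ->]].
  apply: (@span_sub _ [set x | exists c : 'I_(size s) -> R,
                         x = \sum_i c i *: s`_i]) => [|y ys].
    apply/submoduleP; split=> [|a _ _ [c ->] [d ->]].
      by exists (fun=> 0); rewrite big1 // => i _; rewrite scale0r.
    exists (fun i => a * c i + d i).
    rewrite scaler_sumr -big_split /=; apply: eq_bigr => i _.
    by rewrite scalerDl scalerA.
  have ys' : y \in s by [].
  have lt_y : (index y s < size s)%N by rewrite index_mem.
  exists (fun i => (i == Ordinal lt_y)%:R).
  rewrite (bigD1 (Ordinal lt_y)) //= eqxx scale1r nth_index // big1 ?addr0 //.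
  by move=> i /negPf->; rewrite scale0r.
have /submoduleP[s0 sl] := span_submodule [set` s].
elim/big_ind: _ => [//|u v su sv|i _].
  by rewrite -[u]scale1r; exact: sl.
by rewrite -[_ *: _]addr0; apply: sl => //; apply: sub_span; apply: mem_nth.
Qed.

End Submodules.

Definition noetherian (R : comPzRingType) : Prop :=
  forall I : set R^o, submodule I -> fin_gen I.

(* The localization of a ring at a multiplicative set, as the quotient of     *)
(* R * S by (r, s) ~ (r', s') iff t r s' = t r' s for some t in S.            *)
Module Localization.
Section Localization.
Variables (R : comPzRingType) (S : mulrClosed R).

Local Notation frac := (R * {s : R | s \in S})%type.
Implicit Types (x y z : frac).

Definition den x : R := val x.2.

Lemma denP x : den x \in S. Proof. exact: valP. Qed.

Definition mkfrac (r s : R) (sS : s \in S) : frac := (r, Sub s sS).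

Definition equivf x y : bool :=
  `[< exists2 t, t \in S & t * (x.1 * den y) = t * (y.1 * den x) >].

Lemma equivfP x y :
  reflect (exists2 t, t \in S & t * (x.1 * den y) = t * (y.1 * den x))
          (equivf x y).
Proof. exact: asboolP. Qed.

Lemma equivf_refl : reflexive equivf.
Proof. by move=> x; apply/equivfP; exists 1; rewrite ?rpred1. Qed.

Lemma equivf_sym : symmetric equivf.
Proof. by move=> x y; apply/equivfP/equivfP => -[t tS e]; exists t. Qed.

Lemma equivf_trans : transitive equivf.
Proof.
move=> y x z /equivfP[t tS e] /equivfP[u uS f].
apply/equivfP; exists (t * u * den y); first by rewrite !rpredM ?denP.
transitivity ((t * (x.1 * den y)) * (u * den z)); first by ring.
rewrite e; transitivity ((u * (y.1 * den z)) * (t * den x)); first by ring.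
by rewrite f; ring.
Qed.

Canonical equivf_equiv := EquivRel equivf equivf_refl equivf_sym equivf_trans.

Definition type := {eq_quot equivf}.
#[export]
HB.instance Definition _ : EqQuotient _ equivf type := EqQuotient.on type.
#[export]
HB.instance Definition _ := Choice.on type.

Lemma mkfracM_subproof x y : den x * den y \in S.
Proof. by rewrite rpredM ?denP. Qed.

Definition addf x y : frac :=
  mkfrac (x.1 * den y + y.1 * den x) (mkfracM_subproof x y).
Definition mulf x y : frac := mkfrac (x.1 * y.1) (mkfracM_subproof x y).
Definition oppf x : frac := (- x.1, x.2).
Definition embf (r : R) : frac := mkfrac r (rpred1 S).

Definition add := lift_op2 type addf.
Definition mul := lift_op2 type mulf.
Definition opp := lift_op1 type oppf.
Definition emb (r : R) : type := lift_embed type embf r.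
Canonical emb_pi_morph := PiEmbed emb.

Lemma eq_pi x y : equivf x y -> \pi_type x = \pi_type y.
Proof. by move=> xy; apply/eqmodP. Qed.

Lemma reprP x : equivf x (repr (\pi_type x)).
Proof. by apply/eqmodP; rewrite reprK. Qed.

Lemma pi_add : {morph \pi : x y / addf x y >-> add x y}.
Proof.
move=> x y; unlock add; apply: eq_pi.
have /equivfP[t tS e] := reprP x; have /equivfP[u uS f] := reprP y.
set x' := repr _ in e *; set y' := repr _ in f *.
apply/equivfP; exists (t * u); first by rewrite rpredM.
rewrite /addf /mkfrac /den /= -!/(den _).
transitivity ((t * (x.1 * den x')) * (u * (den y * den y'))
  + (u * (y.1 * den y')) * (t * (den x * den x'))); first by ring.
by rewrite e f; ring.
Qed.
Canonical pi_add_morph := PiMorph2 pi_add.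

Lemma pi_mul : {morph \pi : x y / mulf x y >-> mul x y}.
Proof.
move=> x y; unlock mul; apply: eq_pi.
have /equivfP[t tS e] := reprP x; have /equivfP[u uS f] := reprP y.
set x' := repr _ in e *; set y' := repr _ in f *.
apply/equivfP; exists (t * u); first by rewrite rpredM.
rewrite /mulf /mkfrac /den /= -!/(den _).
transitivity ((t * (x.1 * den x')) * (u * (y.1 * den y'))); first by ring.
by rewrite e f; ring.
Qed.
Canonical pi_mul_morph := PiMorph2 pi_mul.

Lemma pi_opp : {morph \pi : x / oppf x >-> opp x}.
Proof.
move=> x; unlock opp; apply: eq_pi.
have /equivfP[t tS e] := reprP x.
apply/equivfP; exists t => //.
by rewrite /oppf /den /= -!/(den _) !mulNr !mulrN e.
Qed.
Canonical pi_opp_morph := PiMorph1 pi_opp.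

Lemma eq1 x y : x.1 * den y = y.1 * den x -> \pi_type x = \pi_type y.
Proof. by move=> e; apply/eq_pi/equivfP; exists 1; rewrite ?rpred1 // e. Qed.

Ltac loc := rewrite !piE; apply: eq1; unfold addf, mulf, oppf, embf, mkfrac, den; simpl; ring.

Lemma addA : associative add.
Proof. by elim/quotW=> x; elim/quotW=> y; elim/quotW=> z; loc. Qed.

Lemma addC : commutative add.
Proof. by elim/quotW=> x; elim/quotW=> y; loc. Qed.

Lemma add0 : left_id (emb 0) add.
Proof. by elim/quotW=> x; loc. Qed.

Lemma addN : left_inverse (emb 0) opp add.
Proof. by elim/quotW=> x; loc. Qed.

#[export]
HB.instance Definition _ := GRing.isZmodule.Build type addA addC add0 addN.

Lemma mulA : associative mul.
Proof. by elim/quotW=> x; elim/quotW=> y; elim/quotW=> z; loc. Qed.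

Lemma mulC : commutative mul.
Proof. by elim/quotW=> x; elim/quotW=> y; loc. Qed.

Lemma mul1 : left_id (emb 1) mul.
Proof. by elim/quotW=> x; loc. Qed.

Lemma mulDl : left_distributive mul add.
Proof. by elim/quotW=> x; elim/quotW=> y; elim/quotW=> z; loc. Qed.

#[export]
HB.instance Definition _ :=
  GRing.Zmodule_isComPzRing.Build type mulA mulC mul1 mulDl.

Lemma emb_is_zmod_morphism : zmod_morphism emb.
Proof.
move=> a b; change (emb (a - b) = add (emb a) (opp (emb b))); loc.
Qed.
#[export]
HB.instance Definition _ :=
  GRing.isZmodMorphism.Build R type emb emb_is_zmod_morphism.

Lemma emb_is_monoid_morphism : monoid_morphism emb.
Proof.
by split=> // a b; change (emb (a * b) = mul (emb a) (emb b)); loc.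
Qed.
#[export]
HB.instance Definition _ :=
  GRing.isMonoidMorphism.Build R type emb emb_is_monoid_morphism.

Definition scale (a : R) (x : type) : type := emb a * x.

Lemma scaleA a b (x : type) : scale a (scale b x) = scale (a * b) x.
Proof. by rewrite /scale rmorphM mulrA. Qed.
Lemma scale1 : left_id 1 scale.
Proof. by move=> x; rewrite /scale rmorph1 mul1r. Qed.
Lemma scaleDr : right_distributive scale +%R.
Proof. by move=> a x y; rewrite /scale mulrDr. Qed.
Lemma scaleDl (x : type) : {morph scale^~ x : a b / a + b}.
Proof. by move=> a b; rewrite /scale rmorphD mulrDl. Qed.

#[export]
HB.instance Definition _ :=
  GRing.Zmodule_isLmodule.Build R type scaleA scale1 scaleDr scaleDl.

Lemma emb_denom_inv s : s \in S -> exists y : type, emb s * y = 1.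
Proof.
move=> sS; exists (\pi_type (mkfrac 1 sS)).
by change (mul (emb s) (\pi_type (mkfrac 1 sS)) = emb 1); loc.
Qed.

Lemma fracP (x : type) :
  exists r s, s \in S /\ emb s * x = emb r.
Proof.
elim/quotW: x => x; exists x.1, (den x); split; first exact: denP.
by change (mul (emb (den x)) (\pi_type x) = emb x.1); loc.
Qed.

Lemma emb_eq0 (r : R) : emb r = 0 <-> exists2 t, t \in S & t * r = 0.
Proof.
change (emb r = emb 0 <-> exists2 t, t \in S & t * r = 0).
have -> : (emb r = emb 0) <-> equivf (embf r) (embf 0).
  by rewrite !piE; split=> [/eqmodP|/eq_pi].
split=> [/equivfP|] [t tS e]; last apply/equivfP; exists t => //.
  by move: e; rewrite /= /den /= mulr1 mul0r mulr0.
by rewrite /= /den /= mulr1 mul0r mulr0.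
Qed.

End Localization.
Module Exports. HB.reexport. End Exports.
End Localization.
Export Localization.Exports.

Notation localization := Localization.type.
Notation loc_emb := Localization.emb.

HB.mixin Record Monoid_isCommutative G of Monoid G := {
  mulgC : forall x y : G, (x * y = y * x)%g
}.

#[short(type="comMonoidType")]
HB.structure Definition ComMonoid := {G of Monoid_isCommutative G & Monoid G}.

Section FgSubmodules.
Variables (R : comPzRingType) (S : mulrClosed R).
Local Notation L := (localization S).
Implicit Types (A B X Y : set L).

Record fg_submodule := FgSubmodule {
  fg_set :> set L;
  fg_setP : submodule fg_set;
  fg_fin_gen : fin_gen fg_set }.

Lemma fg_submodule_eq (A B : fg_submodule) : fg_set A = fg_set B -> A = B.
Proof.
case: A B => [A A1 A2] [B B1 B2] /= AB; case: _ / AB in B1 B2 *.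
by rewrite (Prop_irrelevance A1 B1) (Prop_irrelevance A2 B2).
Qed.

HB.instance Definition _ := gen_eqMixin fg_submodule.
HB.instance Definition _ := gen_choiceMixin fg_submodule.

Lemma loc_scaleAl (a : R) (x y : L) : a *: (x * y) = (a *: x) * y.
Proof. exact: mulrA. Qed.

Lemma loc_scaleAr (a : R) (x y : L) : a *: (x * y) = x * (a *: y).
Proof. by rewrite mulrC loc_scaleAl mulrC. Qed.

Definition prod_set A B : set L := span [set a * b | a in A & b in B].

Lemma prod_setC A B : prod_set A B = prod_set B A.
Proof.
congr span; apply/seteqP.
by split=> x [a Aa [b Bb <-]]; exists b => //; exists a; rewrite // mulrC.
Qed.

Lemma prod_span X Y : prod_set (span X) (span Y) = prod_set X Y.
Proof.
have half (X' Y' : set L) : prod_set (span X') Y' = prod_set X' Y'.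
  apply/seteqP; split; last first.
    apply: span_mono => _ [a Xa [b Yb <-]].
    by exists a; [exact: sub_span|exists b].
  apply: span_sub; first exact: span_submodule.
  move=> _ [a Xa [b Yb <-]]; move: a Xa.
  apply: (@span_sub _ _ X' [set a | prod_set X' Y' (a * b)]) => [|a Xa].
    have /submoduleP[P0 Pl] := span_submodule [set a * b | a in X' & b in Y'].
    apply/submoduleP; rewrite /= mul0r; split=> // c u v Pu Pv.
    by rewrite mulrDl -loc_scaleAl; exact: Pl.
  by apply: sub_span; exists a => //; exists b.
by rewrite half prod_setC half prod_setC.
Qed.

Lemma prod_set_submodule A B : submodule (prod_set A B).
Proof. exact: span_submodule. Qed.

Lemma prod_set_fin_gen (A B : fg_submodule) : fin_gen (prod_set A B).
Proof.
have [X Xf AX] := fg_fin_gen A; have [Y Yf BY] := fg_fin_gen B.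
rewrite AX BY prod_span; eexists; last reflexivity.
exact: finite_image2.
Qed.

Definition fg_mul (A B : fg_submodule) : fg_submodule :=
  FgSubmodule (prod_set_submodule A B) (prod_set_fin_gen A B).

Definition fg_one : fg_submodule :=
  FgSubmodule (@span_submodule _ L [set 1])
              (ex_intro2 _ _ [set 1] (finite_set1 1) erefl).

Lemma fg_mulA : associative fg_mul.
Proof.
move=> A B C; apply: fg_submodule_eq => /=.
rewrite -(span_id (fg_setP A)) -(span_id (fg_setP C)).
rewrite !{2 4}/prod_set !prod_span !(span_id (fg_setP _)).
congr span; apply/seteqP; split=> x.
  move=> [a Aa [_ [b Bb [c Cc <-]] <-]]; rewrite mulrA.
  by exists (a * b); [exists a => //; exists b|exists c].
move=> [_ [a Aa [b Bb <-]] [c Cc <-]]; rewrite -mulrA.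
by exists a => //; exists (b * c) => //; exists b => //; exists c.
Qed.

Lemma fg_mulC : commutative fg_mul.
Proof. by move=> A B; apply: fg_submodule_eq; exact: prod_setC. Qed.

Lemma fg_mul1 : left_id fg_one fg_mul.
Proof.
move=> A; apply: fg_submodule_eq => /=.
rewrite -{1}(span_id (fg_setP A)) prod_span -{2}(span_id (fg_setP A)).
congr span; apply/seteqP; split=> [_ [_ -> [a Aa <-]]|a Aa].
  by rewrite mul1r.
by exists 1 => //; exists a; rewrite ?mul1r.
Qed.

Lemma fg_mulr1 : right_id fg_one fg_mul.
Proof. by move=> A; rewrite fg_mulC fg_mul1. Qed.

HB.instance Definition _ :=
  isMonoid.Build fg_submodule fg_mulA fg_mul1 fg_mulr1.
HB.instance Definition _ := Monoid_isCommutative.Build fg_submodule fg_mulC.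

End FgSubmodules.

Section Presentations.
Variable R : comPzRingType.

Record presentation (M : lmodType R) := Presentation {
  pres_gens : nat;
  pres_rels : nat;
  pres_mx : 'M[R]_(pres_gens, pres_rels);
  pres_aug : {linear 'cV[R]_pres_gens -> M};
  pres_surj : range pres_aug = setT;
  pres_exact : range (mulmx pres_mx : 'cV_pres_rels -> _) = pres_aug @^-1` [set 0] }.

Definition minors a b (h : 'M[R]_(a, b)) : set R :=
  [set \det (colsub f h) | f in [set f : 'I_a -> 'I_b | {homo f : i j / (i < j)%N}]].

Definition minors_ideal a b (h : 'M[R]_(a, b)) : set R^o := span (minors h : set R^o).

Section LinComb.
Variables (M : lmodType R) (n : nat) (g : 'I_n -> M).

Definition lincomb (v : 'cV[R]_n) : M := \sum_i v i 0 *: g i.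

Lemma lincomb_is_linear : linear lincomb.
Proof.
move=> a u v; rewrite /lincomb scaler_sumr -big_split /=.
by apply: eq_bigr => i _; rewrite !mxE scalerDl scalerA.
Qed.
HB.instance Definition _ :=
  GRing.isLinear.Build R 'cV[R]_n M *:%R lincomb lincomb_is_linear.

End LinComb.

Lemma fin_gen_span_seq (M : lmodType R) (A : set M) :
  fin_gen A -> exists s : seq M, A = span [set` s].
Proof. by move=> [X /finite_seqP[s ->] ->]; exists s. Qed.

Lemma noetherian_col (hR : noetherian R) n (K : set 'cV[R]_n) :
  submodule K ->
  exists b (h : 'M[R]_(n, b)), range (mulmx h : 'cV_b -> _) = K.
Proof.
elim: n K => [|n IHn] K /submoduleP[K0 Kl].
  exists 0%N, 0; apply/seteqP; split=> [_ [w _ <-]|v _].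
    by rewrite mul0mx.
  by exists 0 => //; rewrite mulmx0 [v]flatmx0.
have KD u v : K u -> K v -> K (u + v).
  by move=> Ku Kv; rewrite -[u]scale1r; exact: Kl.
have KZ a u : K u -> K (a *: u).
  by move=> Ku; rewrite -[_ *: _]addr0; exact: Kl.
pose I : set R^o := [set x | exists2 v, K v & v ord0 0 = x].
have /hR/fin_gen_span_seq[s Is] : submodule I.
  apply/submoduleP; split; first by exists 0; rewrite ?mxE.
  move=> a _ _ [u Ku <-] [v Kv <-].
  by exists (a *: u + v); [exact: Kl|rewrite !mxE].
have /choice[g gP] (i : 'I_(size s)) : exists v, K v /\ v ord0 0 = s`_i.
  suff [v Kv vE] : I s`_i by exists v.
  by rewrite Is; apply: sub_span; exact: mem_nth.
pose K' : set 'cV[R]_n := [set v | K (col_mx (0 : 'cV_1) v)].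
have /IHn[b' [h' h'K]] : submodule K'.
  apply/submoduleP; rewrite /K' /= col_mx0; split=> // a u v Ku Kv.
  have -> : col_mx (0 : 'cV_1) (a *: u + v) = a *: col_mx 0 u + col_mx 0 v.
    by rewrite scale_col_mx add_col_mx scaler0 addr0.
  exact: Kl.
pose H1 : 'M[R]_(1 + n, size s) := \matrix_(i, j) g j i 0.
have H1K c : K (H1 *m c).
  have -> : H1 *m c = \sum_j c j 0 *: g j.
    apply/matrixP => i k; rewrite ord1 mxE summxE.
    by apply: eq_bigr => j _; rewrite !mxE mulrC.
  by elim/big_ind: _ => // j _; apply: KZ; case: (gP j).
pose H : 'M[R]_(1 + n, size s + b') := row_mx H1 (col_mx 0 h').
have HE (u : 'cV_(size s)) (w : 'cV_b') :
    H *m col_mx u w = H1 *m u + col_mx 0 (h' *m w) :> 'cV_(1 + n).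
  by rewrite mul_row_col mul_col_mx mul0mx.
exists (size s + b')%N, H.
apply/seteqP; split=> [_ [w _ <-]|v Kv].
  rewrite -[w]vsubmxK HE; apply: KD => //.
  suff : K' (h' *m dsubmx w) by [].
  by rewrite -h'K; exists (dsubmx w).
have : I (v ord0 0) by exists v.
rewrite Is => /span_seqP[c cE].
pose c' : 'cV[R]_(size s) := \col_i c i.
pose v' : 'cV[R]_(1 + n) := v - H1 *m c'.
have v'E : v' = col_mx 0 (dsubmx v').
  rewrite -{1}[v']vsubmxK; congr col_mx; apply/matrixP => i j.
  rewrite !ord1 !mxE lshift0 cE; apply/eqP; rewrite subr_eq0; apply/eqP.
  by apply: eq_bigr => k _; rewrite !mxE; have [_ ->] := gP k; rewrite mulrC.
have : K' (dsubmx v').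
  rewrite /K' /= -v'E /v' addrC -scaleN1r; exact: Kl.
rewrite -h'K => -[w _ wE].
exists (col_mx c' w) => //.
by rewrite HE wE -v'E /v' addrC subrK.
Qed.

Lemma noetherian_presentation (hR : noetherian R) (M : lmodType R) :
  fin_gen [set: M] -> exists p : presentation M, True.
Proof.
move=> /fin_gen_span_seq[s Ms].
pose eps : {linear 'cV[R]_(size s) -> M} := lincomb (fun i : 'I_(size s) => s`_i).
have [|b [h hE]] := @noetherian_col hR _ (eps @^-1` [set 0]).
  apply/submoduleP; split=> [|a u v u0 v0]; first exact: linear0.
  by change (eps (a *: u + v) = 0); rewrite linearP [eps u]u0 [eps v]v0 scaler0 addr0.
suff es : range eps = setT by exists (Presentation es hE).
apply/seteqP; split=> // x _.
have : [set: M] x by [].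
rewrite Ms => /span_seqP[c ->]; exists (\col_i c i) => //.
by apply: eq_bigr => i _; rewrite mxE.
Qed.

Lemma det_colsub_minors a b (h : 'M[R]_(a, b)) (f : 'I_a -> 'I_b) :
  minors_ideal h (\det (colsub f h)).
Proof.
have /submoduleP[m0 ml] := @span_submodule _ R^o (minors h).
case: (pselect (injective f)) => [f_inj|]; last first.
  move=> /existsNP[i /existsNP[j /not_implyP[fij /eqP ij]]].
  rewrite -det_tr (determinant_alternate ij) // => k.
  by rewrite !mxE fij.
have b0 (i : 'I_a) : 'I_b by exact: f i.
pose s := [seq i <- enum 'I_b | i \in codom f].
have ss : sorted ltn (map val s).
  have -> : map val s = [seq i <- map val (enum 'I_b) | i \in map val (codom f)].
    rewrite filter_map; congr map; apply: eq_filter => i /=.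
    by rewrite (mem_map val_inj).
  by apply: sorted_filter; [exact: ltn_trans|rewrite val_enum_ord iota_ltn_sorted].
have sz : size s = a.
  rewrite -[RHS]card_ord -(card_codom f_inj) cardE; congr size.
  by rewrite /enum_mem /s enumT; apply: eq_filter.
have sP i : f i \in s by rewrite mem_filter codom_f mem_enum.
have lt_i i : (index (f i) s < a)%N by have := sP i; rewrite -index_mem sz.
pose r i : 'I_a := Ordinal (lt_i i).
have r_inj : injective r.
  move=> i j /(congr1 val) /= rij; apply: f_inj.
  by rewrite -(nth_index (f i) (sP i)) rij nth_index.
pose g (i : 'I_a) := nth (f i) s i.
have fE i : f i = g (r i) by rewrite /g /= (set_nth_default (f i)) ?nth_index ?index_mem.
have g_mono : {homo g : i j / (i < j)%N}.
  move=> i j ij; rewrite /g (set_nth_default (f i) (f j)) ?sz //.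
  have := @sorted_ltn_nth _ ltn ltn_trans 0%N _ ss i j.
  rewrite !inE size_map sz => /(_ (ltn_ord i) (ltn_ord j) ij).
  by rewrite !(nth_map (f i)) ?sz.
have -> : colsub f h = col_perm (perm r_inj) (colsub g h).
  by apply/matrixP => i j; rewrite !mxE permE fE.
rewrite col_permE det_mulmx det_perm mulrC -[_ * _]addr0.
by apply: ml => //; apply: sub_span; exists g.
Qed.

Lemma det_mul_minors a b (h : 'M[R]_(a, b)) (W : 'M[R]_(b, a)) :
  minors_ideal h (\det (h *m W)).
Proof.
have /submoduleP[m0 ml] := @span_submodule _ R^o (minors h).
rewrite -det_tr trmx_mul.
have -> : \det (W^T *m h^T) = \sum_(f : {ffun 'I_a -> 'I_b})
    (\prod_i W (f i) i) * \det (colsub f h).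
  under [RHS]eq_bigr => f _ do rewrite -det_tr big_distrr.
  rewrite exchange_big /=; apply: eq_bigr => s _.
  under [RHS]eq_bigr => f _ do rewrite mulrCA -big_split.
  rewrite -big_distrr /=; congr (_ * _).
  under eq_bigr => i _ do rewrite mxE.
  rewrite bigA_distr_bigA /=; apply: eq_bigr => f _.
  by apply: eq_bigr => i _; rewrite !mxE.
elim/big_ind: _ => // [x y mx my|f _].
  by rewrite -[x]mul1r; exact: ml.
by rewrite -[_ * _]addr0; apply: ml => //; exact: det_colsub_minors.
Qed.

Lemma minors_ideal_mul a b c (h : 'M[R]_(a, b)) (W : 'M[R]_(b, c)) :
  minors_ideal (h *m W) `<=` minors_ideal h.
Proof.
apply: span_sub; first exact: span_submodule.
by move=> _ [f _ <-]; rewrite -mulmx_colsub; exact: det_mul_minors.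
Qed.

Lemma det_col_minors a b k (h : 'M[R]_(a, b)) (B : 'M[R]_(k, k + a))
    (W : 'M[R]_(b, k + a)) :
  minors_ideal h (\det (col_mx B (h *m W))).
Proof.
have /submoduleP[m0 ml] := @span_submodule _ R^o (minors h).
elim: k B W => [|k IHk] B W.
  have -> : col_mx B (h *m W) = h *m W :> 'M_a.
    apply/matrixP => i j; rewrite -[RHS](col_mxEd B).
    by congr (fun_of_matrix _ _ _); exact: val_inj.
  exact: det_mul_minors.
rewrite (expand_det_row _ (ord0 : 'I_((k + a).+1))).
elim/big_ind: _ => // [x y mx my|j _].
  by rewrite -[x]mul1r; exact: ml.
rewrite -[_ * _]addr0 /cofactor mulrA; apply: ml => //.
have -> : row' (ord0 : 'I_((k + a).+1)) (col' j (col_mx B (h *m W) : 'M_((k + a).+1)))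
     = col_mx (row' ord0 (col' j B)) (h *m col' j W).
  apply/matrixP => i l; rewrite !mxE.
  case: (split_ordP i) => i' ->.
    have -> : lift ord0 (lshift a i') = lshift a (lift ord0 i') by exact: val_inj.
    by rewrite (unsplitK (inl _)) !mxE.
  have -> : lift ord0 (rshift k i') = rshift k.+1 i' by exact: val_inj.
  by rewrite (unsplitK (inr _)) !mxE; apply: eq_bigr => m _; rewrite !mxE.
exact: IHk.
Qed.

Lemma det_mxsub_cast m n (e : m = n) (s : 'I_m -> 'I_n) (A : 'M[R]_n) :
  injective s -> exists i : bool, \det A = (-1) ^+ i * \det (mxsub s (cast_ord e) A).
Proof.
case: n / e s A => s A s_inj; exists (perm s_inj).
have -> : mxsub s (cast_ord erefl) A = row_perm (perm s_inj) A.
  by apply/matrixP => i j; rewrite !mxE permE cast_ord_id.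
by rewrite row_permE det_mulmx det_perm mulrA -signr_addb addbb mul1r.
Qed.

Lemma det_minors_col a b k (h : 'M[R]_(a, b)) (B : 'M[R]_(k, a + k))
    (W : 'M[R]_(b, a + k)) :
  minors_ideal h (\det (col_mx (h *m W) B)).
Proof.
have /submoduleP[m0 ml] := @span_submodule _ R^o (minors h).
pose s (i : 'I_(k + a)) : 'I_(a + k) :=
  match fintype.split i with inl j => rshift a j | inr j => lshift k j end.
have sl i : s (lshift a i) = rshift a i by rewrite /s (unsplitK (inl _)).
have sr i : s (rshift k i) = lshift k i by rewrite /s (unsplitK (inr _)).
have s_inj : injective s.
  move=> i j; case: (split_ordP i) => i' ->; case: (split_ordP j) => j' ->;
    rewrite ?sl ?sr.
  - by move=> /rshift_inj->.
  - by move=> /eqP; rewrite eq_rlshift.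
  - by move=> /eqP; rewrite eq_lrshift.
  - by move=> /lshift_inj->.
have [i ->] := det_mxsub_cast (addnC k a) (col_mx (h *m W) B) s_inj.
rewrite -[_ * _]addr0; apply: ml => //.
set c := cast_ord _.
have -> : mxsub s c (col_mx (h *m W) B) = col_mx (colsub c B) (h *m colsub c W).
  apply/matrixP => p q; rewrite mxE; case: (split_ordP p) => p' ->.
    by rewrite sl !col_mxEd col_mxEu mxE.
  rewrite sr col_mxEu col_mxEd !mxE.
  by apply: eq_bigr => l _; rewrite !mxE.
exact: det_col_minors.
Qed.

Lemma colsub_mul1 a b (h : 'M[R]_(a, b)) c (f : 'I_c -> 'I_b) :
  colsub f h = h *m colsub f 1%:M.
Proof. by rewrite mulmx_colsub mulmx1. Qed.

Lemma minors_ideal_block_l a b k (h : 'M[R]_(a, b)) (C : 'M[R]_(a, k)) :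
  minors_ideal (block_mx 0 1%:M h (- C) : 'M_(k + a, b + k)) = minors_ideal h.
Proof.
apply/seteqP; split; apply: span_sub; try exact: span_submodule.
  move=> _ [f _ <-]; rewrite colsub_mul1; set W := colsub f _.
  rewrite -[W]vsubmxK mul_block_col mul0mx add0r mul1mx.
  have -> : col_mx (dsubmx W) (h *m usubmx W + - C *m dsubmx W)
      = block_mx 1%:M 0 (- C) 1%:M *m col_mx (dsubmx W) (h *m usubmx W).
    by rewrite mul_block_col !mul1mx mul0mx addr0 addrC.
  by rewrite det_mulmx det_lblock !det1 !mul1r; exact: det_col_minors.
move=> _ [f _ <-].
pose W : 'M[R]_(b + k, k + a) := block_mx 0 (colsub f 1%:M) 1%:M 0.
have := @det_mul_minors _ _ (block_mx 0 1%:M h (- C)) W.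
rewrite mulmx_block !mulmx0 !mul0mx !mulmx1 !addr0 !add0r.
by rewrite -colsub_mul1 det_lblock det1 mul1r.
Qed.

Lemma minors_ideal_block_r a b k (h : 'M[R]_(a, b)) (C : 'M[R]_(a, k)) :
  minors_ideal (block_mx h (- C) 0 1%:M : 'M_(a + k, b + k)) = minors_ideal h.
Proof.
apply/seteqP; split; apply: span_sub; try exact: span_submodule.
  move=> _ [f _ <-]; rewrite colsub_mul1; set W := colsub f _.
  rewrite -[W]vsubmxK mul_block_col mul0mx add0r mul1mx.
  have -> : col_mx (h *m usubmx W + - C *m dsubmx W) (dsubmx W)
      = block_mx 1%:M (- C) 0 1%:M *m col_mx (h *m usubmx W) (dsubmx W).
    by rewrite mul_block_col !mul1mx mul0mx add0r.
  by rewrite det_mulmx det_ublock !det1 !mul1r; exact: det_minors_col.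
move=> _ [f _ <-].
pose W : 'M[R]_(b + k, a + k) := block_mx (colsub f 1%:M) 0 0 1%:M.
have := @det_mul_minors _ _ (block_mx h (- C) 0 1%:M) W.
rewrite mulmx_block !mulmx0 !mul0mx !mulmx1 !addr0 !add0r.
by rewrite -colsub_mul1 det_ublock det1 mulr1.
Qed.

Lemma mulmx_cols a b c (h : 'M[R]_(a, b)) (K : 'M[R]_(a, c)) :
  (forall j, range (mulmx h : 'cV_b -> _) (col j K)) -> exists W, K = h *m W.
Proof.
move=> /(_ _)/cid2-/all_sig2[w _ wE]; exists (\matrix_(i, j) w j i 0).
apply/matrixP => i j; have /matrixP/(_ i 0) := wE j; rewrite !mxE => <-.
by apply: eq_bigr => k _; rewrite !mxE.
Qed.

Definition fitting_of (M : lmodType R) (p : presentation M) : set R^o :=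
  minors_ideal (pres_mx p).

Lemma pres_augP (M : lmodType R) (p : presentation M) v :
  pres_aug p v = 0 <-> exists w, pres_mx p *m w = v.
Proof.
have := pres_exact p; move=> /seteqP[h1 h2]; split=> [/h2[w _ <-]|[w <-]].
  by exists w.
by apply: h1; exists w.
Qed.

Lemma pres_lift (M : lmodType R) (p : presentation M) n
    (f : {linear 'cV[R]_n -> M}) :
  exists C : 'M[R]_(pres_gens p, n), forall v, pres_aug p (C *m v) = f v.
Proof.
have /choice[g gP] (j : 'I_n) : exists v, pres_aug p v = f (delta_mx j 0).
  have : range (pres_aug p) (f (delta_mx j 0)) by rewrite pres_surj.
  by move=> [v _ <-]; exists v.
exists (\matrix_(i, j) g j i 0) => v.
have -> : (\matrix_(i, j) g j i 0) *m v = \sum_j v j 0 *: g j.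
  apply/matrixP => i k; rewrite ord1 mxE summxE.
  by apply: eq_bigr => j _; rewrite !mxE mulrC.
rewrite linear_sum [in RHS](matrix_sum_delta v) linear_sum.
apply: eq_bigr => j _; rewrite big_ord_recl big_ord0 addr0 !linearZ /= gP.
by congr (v _ _ *: f (delta_mx _ _)); exact: val_inj.
Qed.

Lemma fitting_of_indep (M : lmodType R) (p q : presentation M) :
  fitting_of p = fitting_of q.
Proof.
have [C CE] := pres_lift p (pres_aug q).
have [D DE] := pres_lift q (pres_aug p).
set hp := pres_mx p in CE *; set hq := pres_mx q in DE *.
rewrite /fitting_of -(minors_ideal_block_l hp C) -(minors_ideal_block_r hq D).
pose eps (v : 'cV[R]_(pres_gens q + pres_gens p)) :=
  pres_aug q (usubmx v) + pres_aug p (dsubmx v).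
have epsP v : eps v = 0 <->
    exists w, block_mx 0 1%:M hp (- C) *m w = v.
  have -> : eps v = pres_aug p (C *m usubmx v + dsubmx v) by rewrite linearD CE.
  split=> [/pres_augP[w wE]|[w <-]].
    exists (col_mx w (usubmx v)); rewrite mul_block_col mul0mx mul1mx add0r wE.
    by rewrite mulNmx addrAC subrr add0r vsubmxK.
  rewrite -[w]vsubmxK mul_block_col col_mxKu col_mxKd mul0mx mul1mx add0r.
  by rewrite addrC mulNmx subrK; apply/pres_augP; eexists.
have epsQ v : eps v = 0 <->
    exists w, block_mx hq (- D) 0 1%:M *m w = v.
  have -> : eps v = pres_aug q (usubmx v + D *m dsubmx v) by rewrite linearD DE.
  split=> [/pres_augP[w wE]|[w <-]].
    exists (col_mx w (dsubmx v)); rewrite mul_block_col mul0mx mul1mx add0r wE.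
    by rewrite mulNmx addrK vsubmxK.
  rewrite -[w]vsubmxK mul_block_col col_mxKu col_mxKd mul0mx mul1mx add0r.
  by rewrite mulNmx subrK; apply/pres_augP; eexists.
apply/seteqP; split.
  have [j|W ->] := @mulmx_cols _ _ _ (block_mx hq (- D) 0 1%:M)
                                (block_mx 0 1%:M hp (- C)).
    have /epsQ[w wE] : eps (col j (block_mx 0 1%:M hp (- C))) = 0.
      by apply/epsP; exists (delta_mx j 0); rewrite colE.
    by exists w.
  exact: minors_ideal_mul.
have [j|W ->] := @mulmx_cols _ _ _ (block_mx 0 1%:M hp (- C))
                              (block_mx hq (- D) 0 1%:M).
  have /epsP[w wE] : eps (col j (block_mx hq (- D) 0 1%:M)) = 0.
    by apply/epsQ; exists (delta_mx j 0); rewrite colE.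
  by exists w.
exact: minors_ideal_mul.
Qed.

Lemma finite_minors a b (h : 'M[R]_(a, b)) : finite_set (minors h).
Proof.
apply: (@sub_finite_set _ _
  ((fun f : {ffun 'I_a -> 'I_b} => \det (colsub f h)) @` setT)).
  move=> _ [f _ <-]; exists (finfun f) => //.
  by congr (\det _); apply: eq_colsub => i; rewrite ffunE.
exact/finite_image/finite_finset.
Qed.

End Presentations.

Section HomologicalAlgebra.
Variable R : comPzRingType.

Definition exact (M N P : lmodType R) (f : {linear M -> N}) (g : {linear N -> P}) : Prop :=
  range f = g @^-1` [set 0].

Definition short_exact (M N P : lmodType R)
    (f : {linear M -> N}) (g : {linear N -> P}) : Prop :=
  [/\ injective f, exact f g & range g = setT].

Definition projective (P : lmodType R) : Prop :=
  forall (M N : lmodType R) (g : {linear M -> N}) (f : {linear P -> N}),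
    range g = setT -> exists h : {linear P -> M}, g \o h =1 f.

Record proj_resolution (M : lmodType R) := ProjResolution {
  res_obj : nat -> lmodType R;
  res_d : forall n, {linear res_obj n.+1 -> res_obj n};
  res_aug : {linear res_obj 0 -> M};
  res_projective : forall n, projective (res_obj n);
  res_aug_surj : range res_aug = setT;
  res_exact0 : exact (res_d 0) res_aug;
  res_exact : forall n, exact (res_d n.+1) (res_d n) }.

(* pd_R(M) <= n *)
Definition proj_dim_le (M : lmodType R) (n : nat) : Prop :=
  exists r : proj_resolution M,
    forall i, (n < i)%N -> forall x : res_obj r i, x = 0.

End HomologicalAlgebra.

Section FittingInvariants.
Variables (R : comPzRingType) (S : mulrClosed R).

Record tors_module := TorsModule {
  tors_sort :> lmodType R;
  tors_fin_gen : fin_gen [set: tors_sort];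
  tors_torsion : forall x : tors_sort, exists2 s, s \in S & s *: x = 0 }.

Definition fitting_invariant (Omega : comMonoidType) (F : tors_module -> Omega) : Prop :=
  (forall P : tors_module, proj_dim_le P 1 ->
     exists omega : Omega, (F P * omega = 1)%g) /\
  (forall (M' M P : tors_module) (f : {linear M' -> M}) (g : {linear M -> P}),
     proj_dim_le P 1 -> short_exact f g -> F M = (F P * F M')%g).

(* The initial Fitting ideal; see [fitting_idealE] for the independence of    *)
(* the presentation chosen here.                                              *)
Definition fitting_ideal (hR : noetherian R) (M : tors_module) : set R^o :=
  fitting_of (projT1 (cid (noetherian_presentation hR (tors_fin_gen M)))).

Lemma fitting_idealE hR (M : tors_module) (p : presentation M) :
  fitting_ideal hR M = minors_ideal (pres_mx p).
Proof. exact: fitting_of_indep. Qed.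

Lemma image_emb_span (X : set R^o) :
  [set loc_emb S x | x in span X] = span [set loc_emb S x | x in X].
Proof.
have embl a (x y : R^o) :
    loc_emb S (a *: x + y) = a *: loc_emb S x + loc_emb S y.
  by rewrite rmorphD rmorphM.
apply/seteqP; split=> [_ [x Xx <-]|].
  apply: (@span_sub _ _ X [set x | span [set loc_emb S x | x in X] (loc_emb S x)])
    x Xx => [|x Xx].
    have /submoduleP[P0 Pl] := span_submodule [set loc_emb S x | x in X].
    apply/submoduleP; split=> [|a u v Pu Pv]; rewrite /= ?rmorph0 //.
    by rewrite embl; exact: Pl.
  by apply: sub_span; exists x.
apply: span_sub => [|_ [x Xx <-]]; last by exists x => //; exact: sub_span.
have /submoduleP[P0 Pl] := span_submodule X.
apply/submoduleP; split=> [|a _ _ [u Xu <-] [v Xv <-]].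
  by exists 0 => //; exact: rmorph0.
by exists (a *: u + v); [exact: Pl|exact: embl].
Qed.

Lemma emb_fitting_submodule hR (M : tors_module) :
  submodule [set loc_emb S x | x in fitting_ideal hR M].
Proof. by rewrite image_emb_span; exact: span_submodule. Qed.

Lemma emb_fitting_fin_gen hR (M : tors_module) :
  fin_gen [set loc_emb S x | x in fitting_ideal hR M].
Proof.
rewrite image_emb_span; eexists; last reflexivity.
exact/finite_image/finite_minors.
Qed.

(* Fitt_R(M), seen inside the localization along the canonical map, which is  *)
(* injective when S consists of non-zero-divisors.                            *)
Definition fitting_map (hR : noetherian R) (M : tors_module) : fg_submodule S :=
  FgSubmodule (emb_fitting_submodule hR M) (emb_fitting_fin_gen hR M).

End FittingInvariants.

(* Main.v *)
(* A module P of projective dimension at most 1 has a presentation matrix h   *)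
(* whose syzygy module is projective; splitting off the syzygies gives an e   *)
(* with h e = h, and torsion gives s in S and k with h k = s and k h = s e.   *)
(* By Cauchy-Binet the ideals of maximal minors of h and k then multiply to s *)
(* ^ a R, so Fitt(P) is invertible. For an extension of P by M', the          *)
(* horseshoe lemma presents M by [[h', C], [0, h]] where C can be chosen with *)
(* C = C e; multiplying on the left by [[s, - C k], [0, 1]] clears C, so      *)
(* that, s being regular, the maximal minors are those of diag(h', h), each   *)
(* of which vanishes or is a product of a minor of h' and a minor of h.       *)

Require Import Defs.
From HB Require Import structures.
From mathcomp Require Import all_boot all_algebra.
From mathcomp Require Import perm boolp classical_sets functions cardinality.
From mathcomp Require Import zify.
(* [span] must be that of [Defs], not that of [vector]. *)
Import Defs.

Set Implicit Arguments.
Unset Strict Implicit.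
Unset Printing Implicit Defensive.

Import GRing.Theory.

Local Open Scope classical_set_scope.
Local Open Scope ring_scope.

(** Let [h], with [a] rows, present a torsion module [P] with [pd P <= 1]. Torsion alone gives [K]
    with [h *m K = s%:M] for some [s] in [S]. Since the syzygies of [h] form a projective module,
    there is [e] with [h *m e = h] that kills the kernel of [h] ([pd1_splitting]), and [k = e *m K]
    then satisfies both [h *m k = s%:M] and [k *m h = s *: e] ([pd1_cofactor]).

    Invertibility: a maximal minor of [h] times one of [k] is a minor of [s *: e], hence a multiple
    of [s ^+ a], while Cauchy-Binet ([det_mul_minors_prod]) writes [s ^+ a = \det (h *m k)] through
    such products. So the inverse of Fitt(P) is [s ^- a] times the ideal of maximal minors of [k].

    Multiplicativity: Fitting ideals do not depend on the presentation, so an extension may be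
    presented by the horseshoe matrix ([presentation_extension]). Its off-diagonal block has the
    form [C *m e], and [k] clears it at the cost of a power of the regular element [s]
    ([minors_ideal_extension]). For a block-diagonal matrix the ideal of maximal minors is the
    product of the two ideals ([minors_ideal_diag]). *)

(** * Lifting maps out of projective and free modules *)

Section ImageModule.
Variables (R : comPzRingType) (M N : lmodType R) (g : {linear M -> N}).

Definition image_pred : {pred N} := [pred y | `[< range g y >]].

Lemma image_pred_closed : submod_closed image_pred.
Proof.
split; first by apply/asboolP; exists 0; rewrite ?linear0.
move=> a _ _ /asboolP[u _ <-] /asboolP[v _ <-]; apply/asboolP.
by exists (a *: u + v); rewrite ?linearP.
Qed.

HB.instance Definition _ := GRing.isSubmodClosed.Build R N image_pred
  image_pred_closed.

Definition image_module := {y | y \in image_pred}.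
HB.instance Definition _ := SubType.on image_module.
HB.instance Definition _ := Choice.on image_module.
HB.instance Definition _ := [SubChoice_isSubLmodule of image_module by <:].

Definition to_image (P : lmodType R) (f : {linear P -> N})
    (fg : range f `<=` range g) (x : P) : image_module :=
  Sub (f x) (introT (asboolP _) (fg _ (imageT f x))).

Lemma to_image_linear (P : lmodType R) (f : {linear P -> N})
  (fg : range f `<=` range g) : linear (to_image fg).
Proof. by move=> a u v; apply: val_inj; rewrite /= linearP. Qed.

HB.instance Definition _ (P : lmodType R) (f : {linear P -> N})
    (fg : range f `<=` range g) :=
  GRing.isLinear.Build R P image_module *:%R (to_image fg) (to_image_linear fg).

(** [projective] only lifts along surjections, so [f] and [g] are both corestricted to the image of
    [g], as maps to [image_module]. *)
Lemma projective_lift (P : lmodType R) (f : {linear P -> N}) :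
  projective P -> range f `<=` range g ->
  exists h : {linear P -> M}, forall x, g (h x) = f x.
Proof.
move=> projP fg.
have [|h hE] := projP _ _ (to_image (@subset_refl _ (range g))) (to_image fg).
  apply/seteqP; split=> // -[y yP] _.
  have [x _ xy] := asboolW yP.
  by exists x => //; apply: val_inj.
by exists h => x; have /(congr1 val) := hE x.
Qed.

End ImageModule.

Lemma linear_cV_exists (R : comPzRingType) (M : lmodType R) n (m : 'I_n -> M) :
  exists f : {linear 'cV[R]_n -> M}, forall j, f (delta_mx j 0) = m j.
Proof.
exists (lincomb m) => j; rewrite /= /lincomb (bigD1 j) //= mxE !eqxx scale1r.
by rewrite big1 ?addr0 // => i /negPf ij; rewrite mxE ij scale0r.
Qed.

Lemma linear_cV_sum (R : comPzRingType) (M : lmodType R) n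
    (f : {linear 'cV[R]_n -> M}) v : f v = \sum_j v j 0 *: f (delta_mx j 0).
Proof.
rewrite {1}[v]matrix_sum_delta linear_sum; apply: eq_bigr => j _.
by rewrite big_ord1 linearZ.
Qed.

Lemma mulmx_cV_sum (R : comPzRingType) m n (A : 'M[R]_(m, n)) (v : 'cV_n) :
  A *m v = \sum_j v j 0 *: col j A.
Proof.
apply/matrixP => i k; rewrite ord1 mxE summxE.
by apply: eq_bigr => j _; rewrite !mxE mulrC.
Qed.

Lemma mulmx_cVP (R : comPzRingType) m n (A B : 'M[R]_(m, n)) :
  (forall v : 'cV_n, A *m v = B *m v) -> A = B.
Proof.
move=> AB; apply/matrixP => i j; have /matrixP/(_ i 0) := AB (delta_mx j 0).
by rewrite -!colE !mxE.
Qed.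

Lemma pres_aug_mul (R : comPzRingType) (M : lmodType R) (p : presentation M) w :
  pres_aug p (pres_mx p *m w) = 0.
Proof. by apply/pres_augP; exists w. Qed.

Lemma projective_cV (R : comPzRingType) n : projective 'cV[R]_n.
Proof.
move=> M N g f gT.
have /choice[m mE] (j : 'I_n) : exists x, g x = f (delta_mx j 0).
  have : range g (f (delta_mx j 0)) by rewrite gT.
  by move=> [x _ <-]; exists x.
have [h hE] := linear_cV_exists m; exists h => v /=.
rewrite [h v]linear_cV_sum [in RHS]linear_cV_sum linear_sum.
apply: eq_bigr => j _.
by rewrite linearZ /= hE mE.
Qed.

(** * Presentation matrices in projective dimension at most one *)

(* [e] is the composition of [pres_mx p] with a section of its corestriction  *)
(* to the syzygy module, which is projective by Schanuel's lemma.             *)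
Lemma pd1_splitting (R : comPzRingType) (P : lmodType R) (p : presentation P) :
  proj_dim_le P 1 ->
  exists e : 'M[R]_(pres_rels p), pres_mx p *m e = pres_mx p /\
    forall v : 'cV_(pres_rels p), pres_mx p *m v = 0 -> e *m v = 0.
Proof.
move=> [r r0]; set h := pres_mx p.
have [alpha alphaE] :
  exists alpha : {linear 'cV[R]_(pres_gens p) -> res_obj r 0},
    forall v, res_aug r (alpha v) = pres_aug p v.
  exact: projective_cV (res_aug_surj r).
have [beta betaE] : exists beta : {linear res_obj r 0 -> 'cV[R]_(pres_gens p)},
    forall x, pres_aug p (beta x) = res_aug r x.
  exact: (@res_projective _ _ r 0) (pres_surj p).
have dker x : res_aug r x = 0 -> exists y, res_d r 0 y = x.
  move=> x0; have : range (res_d r 0) x by rewrite (res_exact0 r).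
  by move=> [y _ <-]; exists y.
have augd y : res_aug r (res_d r 0 y) = 0.
  suff : (res_aug r @^-1` [set 0]) (res_d r 0 y) by [].
  by rewrite -(res_exact0 r); exists y.
have dinj y : res_d r 0 y = 0 -> y = 0.
  move=> y0; have : range (res_d r 1) y by rewrite (res_exact r 0).
  by move=> [z _ <-]; rewrite (r0 2%N isT z) linear0.
have [gamma gammaE] :
  exists gamma : {linear res_obj r 1 -> 'cV[R]_(pres_rels p)},
    forall y, h *m gamma y = beta (res_d r 0 y).
  (* [beta \o res_d r 0] lands in the kernel of [pres_aug p], which is the image of [h]. *)
  apply: (@projective_lift _ _ _ (mulmx h) _ (beta \o res_d r 0)).
    exact: res_projective.
  move=> _ [y _ <-].
  have /pres_augP[w wE] : pres_aug p (beta (res_d r 0 y)) = 0.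
    by rewrite betaE augd.
  by exists w.
have /choice[q qE] (j : 'I_(pres_rels p)) :
    exists y, res_d r 0 y = alpha (col j h).
  by apply: dker; rewrite alphaE colE pres_aug_mul.
have /choice[d dE] (i : 'I_(pres_gens p)) :
    exists w, h *m w = delta_mx i 0 - beta (alpha (delta_mx i 0)).
  by apply/pres_augP; rewrite linearB betaE alphaE subrr.
pose D := \matrix_(i, j) d j i 0 : 'M_(pres_rels p, pres_gens p).
have colD j : col j D = d j by apply/matrixP => i k; rewrite !mxE ord1.
have DE x : h *m (D *m x) = x - beta (alpha x).
  rewrite [D *m x]mulmx_cV_sum mulmx_sumr.
  under eq_bigr => j _ do
    rewrite -scalemxAr colD dE scalerBr -[_ *: beta _]linearZ -linearZ /=.
  rewrite sumrB -!linear_sum /=.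
  suff <- : x = \sum_i x i 0 *: delta_mx i 0 by [].
  rewrite {1}[x]matrix_sum_delta; apply: eq_bigr => i _.
  by rewrite big_ord1.
pose G := \matrix_(i, j) gamma (q j) i 0 : 'M_(pres_rels p).
have colG j : col j G = gamma (q j) by apply/matrixP => i k; rewrite !mxE ord1.
have GE v : G *m v = gamma (\sum_j v j 0 *: q j).
  rewrite mulmx_cV_sum linear_sum; apply: eq_bigr => j _.
  by rewrite colG linearZ.
have qsE (v : 'cV_(pres_rels p)) :
    res_d r 0 (\sum_j v j 0 *: q j) = alpha (h *m v).
  rewrite mulmx_cV_sum !linear_sum; apply: eq_bigr => j _.
  by rewrite !linearZ /= qE.
(* On the image of [h], [h *m G] accounts for [beta \o alpha] and [h *m D] for the identity minus
   [beta \o alpha]. If [h *m v = 0], injectivity of [res_d r 0] makes [G *m v] vanish. *)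
exists (G + D *m h); split.
  apply: mulmx_cVP => v; rewrite -mulmxA mulmxDl mulmxDr GE gammaE qsE.
  by rewrite -[D *m h *m v]mulmxA DE addrC subrK.
move=> v hv0; rewrite mulmxDl -[D *m h *m v]mulmxA hv0 mulmx0 addr0 GE.
by rewrite (dinj (\sum_j v j 0 *: q j)) ?linear0 // qsE hv0 linear0.
Qed.

Lemma pd1_cofactor (R : comPzRingType) (S : mulrClosed R) (P : tors_module S)
    (p : presentation P) :
  proj_dim_le P 1 ->
  exists s (k : 'M[R]_(pres_rels p, pres_gens p)) (e : 'M[R]_(pres_rels p)),
    [/\ s \in S, pres_mx p *m k = s%:M, k *m pres_mx p = s *: e
      & pres_mx p *m e = pres_mx p].
Proof.
move=> /(pd1_splitting p)[e [he e0]]; set h := pres_mx p in he e0 *.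
have /choice[t tP] (i : 'I_(pres_gens p)) :
    exists s, s \in S /\ s *: pres_aug p (delta_mx i 0) = 0.
  by have [s] := tors_torsion (pres_aug p (delta_mx i 0)); exists s.
(* [t i] kills the i-th generator, so [s] kills all of [P] and [s%:M] factors through [h]. *)
pose s := \prod_i t i.
have sS : s \in S by apply: rpred_prod => i _; case: (tP i).
have [|K hK] := @mulmx_cols _ _ _ _ h (s%:M).
  move=> j; rewrite (_ : col j s%:M = s *: delta_mx j 0); last first.
    by rewrite colE mul_scalar_mx.
  have /pres_augP[w wE] : pres_aug p (s *: delta_mx j 0) = 0.
    rewrite linearZ /= /s (bigD1 j) //= mulrC -scalerA.
    by have [_ ->] := tP j; rewrite scaler0.
  by exists w.
(* For [k *m h = s *: e]: [h] sends [K *m (h *m v) - s *: v] to 0, hence so does [e]. *)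
exists s, (e *m K), e; split=> //; first by rewrite mulmxA he -hK.
apply: mulmx_cVP => v; apply/eqP; rewrite -subr_eq0; apply/eqP.
rewrite -!mulmxA -scalemxAl scalemxAr -mulmxBr e0 // mulmxBr (mulmxA h K) -hK.
by rewrite mul_scalar_mx -scalemxAr subrr.
Qed.

(* Horseshoe lemma *)
Lemma presentation_extension (R : comPzRingType) (M' M P : lmodType R)
    (f : {linear M' -> M}) (g : {linear M -> P})
    (p' : presentation M') (p : presentation P) (e : 'M[R]_(pres_rels p)) :
  short_exact f g -> pres_mx p *m e = pres_mx p ->
  exists (C : 'M[R]_(pres_gens p', pres_rels p)) (q : presentation M)
    (eg : pres_gens q = (pres_gens p' + pres_gens p)%N)
    (er : pres_rels q = (pres_rels p' + pres_rels p)%N),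
    castmx (eg, er) (pres_mx q) = block_mx (pres_mx p') (C *m e) 0 (pres_mx p).
Proof.
move=> [f_inj fg gT] he; set h := pres_mx p in he *; set h' := pres_mx p'.
have gf x : g (f x) = 0.
  suff : (g @^-1` [set 0]) (f x) by [].
  by rewrite -fg; exists x.
have gker y : g y = 0 -> exists x, f x = y.
  move=> y0; have : range f y by rewrite fg.
  by move=> [x _ <-]; exists x.
have [l lE] : exists l : {linear 'cV[R]_(pres_gens p) -> M},
    forall v, g (l v) = pres_aug p v.
  exact: projective_cV gT.
have /choice[c cE] (j : 'I_(pres_rels p)) :
    exists c, f (pres_aug p' c) = - l (col j h).
  have [x xE] : exists x, f x = - l (col j h).
    by apply: gker; rewrite linearN lE colE pres_aug_mul oppr0.
  have : range (pres_aug p') x by rewrite pres_surj.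
  by move=> [c _ cx]; exists c; rewrite cx.
pose C := \matrix_(i, j) c j i 0 : 'M_(pres_gens p', pres_rels p).
have CE v : f (pres_aug p' (C *m v)) = - l (h *m v).
  rewrite !mulmx_cV_sum !linear_sum; apply: eq_bigr => j _.
  rewrite !linearZ /= -cE; do 3 congr (_ _).
  by apply/matrixP => i k; rewrite !mxE ord1.
(* As [h *m e = h], the block [C *m e] corrects the lifted relations as well as [C] does. *)
have CeE v : f (pres_aug p' (C *m e *m v)) = - l (h *m v).
  by rewrite -mulmxA CE mulmxA he.
pose aug (v : 'cV[R]_(pres_gens p' + pres_gens p)) :=
  f (pres_aug p' (usubmx v)) + l (dsubmx v).
have aug_lin : linear aug.
  by move=> a u v; rewrite /aug !linearP /= scalerDr addrACA.
pose augC := GRing.isLinear.Build R _ _ *:%R aug aug_lin.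
pose augL : {linear 'cV[R]_(pres_gens p' + pres_gens p) -> M} :=
  HB.pack aug augC.
have aug_surj : range augL = setT.
  apply/seteqP; split=> // y _.
  have : range (pres_aug p) (g y) by rewrite pres_surj.
  move=> [v _ vE].
  have [x xE] : exists x, f x = y - l v.
    by apply: gker; rewrite linearB lE vE subrr.
  have : range (pres_aug p') x by rewrite pres_surj.
  move=> [u _ uE]; exists (col_mx u v) => //=.
  by rewrite /aug col_mxKu col_mxKd uE xE subrK.
pose H := block_mx h' (C *m e) 0 h.
have aug_exact : range (mulmx H : 'cV_(_ + _) -> _) = augL @^-1` [set 0].
  apply/seteqP; split=> [_ [w _ <-]|v] /=.
    rewrite -[w]vsubmxK mul_block_col mul0mx add0r /aug col_mxKu col_mxKd.
    by rewrite linearD pres_aug_mul add0r CeE addNr.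
  rewrite /aug => v0.
  have /pres_augP[w wE] : pres_aug p (dsubmx v) = 0.
    by rewrite -lE; have := congr1 g v0; rewrite linearD gf add0r linear0.
  have /pres_augP[w' w'E] : pres_aug p' (usubmx v - C *m e *m w) = 0.
    apply: f_inj; rewrite linear0 -v0 !linearB CeE /= wE opprK; congr (_ + _).
  exists (col_mx w' w) => //.
  by rewrite mul_block_col mul0mx add0r wE w'E subrK vsubmxK.
by exists C, (Presentation aug_surj aug_exact), erefl, erefl.
Qed.

(** * Maximal minors of block-diagonal matrices *)

(** Easy half of Frobenius-König: by pigeonhole every permutation sends some row of [P] to a column
    of [Q], so every term of the expansion vanishes. *)
Lemma det_zero_block (R : comPzRingType) n (A : 'M[R]_n) (P Q : {set 'I_n}) :
  {in P & Q, forall i j, A i j = 0} -> (n < #|P| + #|Q|)%N -> \det A = 0.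
Proof.
move=> A0 nPQ; rewrite /determinant big1 // => s _.
case: (pickP [pred i | (i \in P) && (s i \in Q)]) => [i /andP[iP siQ]|PQ].
  by rewrite (bigD1 i) //= A0 // mul0r mulr0.
have : (#|[set s i | i in P]%SET| <= #|~: Q|)%N.
  apply/subset_leq_card/fintype.subsetP => _ /imsetP[i iP ->].
  by have := PQ i; rewrite /= iP finset.in_setC => /= ->.
rewrite card_imset; last exact: perm_inj.
by have := cardsC Q; rewrite card_ord; lia.
Qed.

Lemma det_colsub_diag (R : comPzRingType) a b c d (A : 'M[R]_(a, b))
    (B : 'M[R]_(c, d)) (f : 'I_(a + c) -> 'I_(b + d)) :
  {homo f : i j / (i < j)%N} ->
  \det (colsub f (block_mx A 0 0 B)) = 0 \/
  exists (f1 : 'I_a -> 'I_b) (f2 : 'I_c -> 'I_d),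
    [/\ {homo f1 : i j / (i < j)%N}, {homo f2 : i j / (i < j)%N}
      & \det (colsub f (block_mx A 0 0 B)) =
        \det (colsub f1 A) * \det (colsub f2 B)].
Proof.
move=> f_mono.
pose Q := [set j | (f j < b)%N]%SET.
have f_le (i j : 'I_(a + c)) : (i <= j)%N -> (f i <= f j)%N.
  by rewrite leq_eqVlt => /orP[/eqP/val_inj->|/f_mono/ltnW].
have f_geb i (j : 'I_(a + c)) : (b <= f j)%N ->
    block_mx A 0 0 B (lshift c i) (f j) = 0.
  case: (split_ordP (f j)) => k ->; first by rewrite /= leqNgt ltn_ord.
  by rewrite block_mxEur !mxE.
have f_ltb i (j : 'I_(a + c)) : (f j < b)%N ->
    block_mx A 0 0 B (rshift a i) (f j) = 0.
  case: (split_ordP (f j)) => k ->; last by [].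
  by rewrite block_mxEdl !mxE.
have card_lo : #|[set i : 'I_(a + c) | (i < a)%N]%SET| = a.
  have -> : [set i : 'I_(a + c) | (i < a)%N]%SET =
      [set lshift c i | i : 'I_a]%SET.
    apply/setP => i; rewrite inE; apply/idP/imsetP => [ia|[j _ ->]]; last first.
      by rewrite /= ltn_ord.
    by exists (Ordinal ia) => //; apply: val_inj.
  by rewrite card_imset ?card_ord //; exact: lshift_inj.
have card_hi : #|[set i : 'I_(a + c) | (a <= i)%N]%SET| = c.
  have := cardsC [set i : 'I_(a + c) | (i < a)%N]%SET.
  rewrite card_lo card_ord => /addnI cE.
  by rewrite -[RHS]cE; apply: eq_card => i; rewrite !inE leqNgt.
have card_Q : (#|Q| + #|~: Q| = a + c)%N by rewrite cardsC card_ord.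
(* [Q] holds the columns taken from [A]. Too few leave an oversized zero block at the top right, too
   many one at the bottom left. With exactly [a], monotonicity makes [Q] the initial segment and [f]
   splits. *)
case: (ltngtP #|Q| a) => Qa.
- left; apply: (@det_zero_block _ _ _
    [set i : 'I_(a + c) | (i < a)%N]%SET (~: Q)%SET).
    move=> i j; rewrite !inE -leqNgt mxE => ia fj.
    case: (split_ordP i) ia => k -> /=; first by move=> _; exact: f_geb.
    by [].
  by rewrite card_lo; have : (a + c < a + #|~: Q|)%N by lia.
- left; apply: (@det_zero_block _ _ _ [set i : 'I_(a + c) | (a <= i)%N]%SET Q).
    move=> i j; rewrite !inE mxE => ia fj.
    case: (split_ordP i) ia => k -> /=; first by rewrite /= leqNgt ltn_ord.
    by move=> _; exact: f_ltb.
  by rewrite card_hi; have : (a + c < c + #|Q|)%N by lia.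
right.
have QE (j : 'I_(a + c)) : (f j < b)%N = (j < a)%N.
  apply/idP/idP => [fj|ja].
    rewrite ltnNge; apply/negP => aj.
    suff : [set i : 'I_(a + c) | (i < a)%N]%SET \proper Q.
      by move/proper_card; rewrite card_lo Qa ltnn.
    apply/properP; split; last by exists j; rewrite inE // ltnNge aj.
    apply/fintype.subsetP => i; rewrite !inE => ia.
    by apply: leq_ltn_trans fj; apply: f_le; lia.
  rewrite ltnNge; apply/negP => bj.
  suff : Q \proper [set i : 'I_(a + c) | (i < a)%N]%SET.
    by move/proper_card; rewrite card_lo Qa ltnn.
  apply/properP; split; last by exists j; rewrite inE // ltnNge bj.
  apply/fintype.subsetP => i; rewrite !inE => fi.
  by apply: leq_ltn_trans ja; rewrite leqNgt; apply/negP => /ltnW/f_le; lia.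
have f1P (i : 'I_a) : (f (lshift c i) < b)%N by rewrite QE /= ltn_ord.
have f2P (i : 'I_c) : (f (rshift a i) - b < d)%N.
  have : (b <= f (rshift a i))%N by rewrite leqNgt QE /= ltnNge leq_addr.
  by have := ltn_ord (f (rshift a i)); lia.
pose f1 i := Ordinal (f1P i); pose f2 i := Ordinal (f2P i).
have f1E i : f (lshift c i) = lshift d (f1 i) by exact: val_inj.
have f2E i : f (rshift a i) = rshift b (f2 i).
  apply: val_inj; rewrite /= subnKC // leqNgt QE /= ltnNge leq_addr //.
exists f1, f2; split.
- by move=> i j ij; exact: f_mono.
- move=> i j ij; rewrite -(ltn_add2l b).
  have := f_mono (rshift a i) (rshift a j); rewrite !f2E /=; apply.
  by rewrite ltn_add2l.
rewrite -(det_ublock _ 0); congr (\det _); apply/matrixP => i j.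
rewrite mxE; case: (split_ordP i) => k ->; case: (split_ordP j) => l ->.
- by rewrite f1E !block_mxEul mxE.
- by rewrite f2E !block_mxEur !mxE.
- by rewrite f1E !block_mxEdl !mxE.
- by rewrite f2E !block_mxEdr mxE.
Qed.

Lemma minors_ideal_diag (R : comPzRingType) a b c d (A : 'M[R]_(a, b))
    (B : 'M[R]_(c, d)) :
  minors_ideal (block_mx A 0 0 B) =
  span ([set x * y | x in minors B & y in minors A] : set R^o).
Proof.
apply/seteqP; split; apply: span_sub; try exact: span_submodule.
  move=> _ [f f_mono <-]; case: (det_colsub_diag A B f_mono) => [->|].
    by have /submoduleP[] := @span_submodule _ R^o
      [set x * y | x in minors B & y in minors A].
  move=> [f1 [f2 [f1_mono f2_mono ->]]]; apply: sub_span.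
  exists (\det (colsub f2 B)); first by exists f2.
  by exists (\det (colsub f1 A)); [exists f1|exact: mulrC].
move=> _ [_ [f2 _ <-] [_ [f1 _ <-] <-]].
(* Multiplying by a 0-1 column-selection matrix realises the product of the two minors. *)
have := @det_mul_minors _ _ _ (block_mx A 0 0 B)
  (block_mx (colsub f1 1%:M) 0 0 (colsub f2 1%:M)).
rewrite mulmx_block !mulmx0 !mul0mx !addr0 !add0r -!colsub_mul1 det_ublock.
by rewrite mulrC.
Qed.

(** * Cauchy-Binet and products of ideals *)

(* Cauchy-Binet *)
Lemma det_mul_minors_prod (R : comPzRingType) a b (h : 'M[R]_(a, b))
    (k : 'M[R]_(b, a)) :
  span ([set x * y | x in minors_ideal h & y in minors_ideal k^T] : set R^o)
    (\det (h *m k)).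
Proof.
set I : set R^o := span _.
have /submoduleP[I0 Il] : submodule I by exact: span_submodule.
have ID : {in I &, forall x y, I (x + y)}.
  by move=> x y; rewrite !inE => Ix Iy; rewrite -[x]scale1r; exact: Il.
have -> : \det (h *m k) = \sum_(f : {ffun 'I_a -> 'I_b})
    (\prod_i k (f i) i) * \det (colsub f h).
  rewrite -det_tr trmx_mul.
  under [RHS]eq_bigr => f _ do rewrite -det_tr big_distrr.
  rewrite exchange_big /=; apply: eq_bigr => s _.
  under [RHS]eq_bigr => f _ do rewrite mulrCA -big_split.
  rewrite -big_distrr /=; congr (_ * _).
  under eq_bigr => i _ do rewrite mxE.
  rewrite bigA_distr_bigA /=; apply: eq_bigr => f _.
  by apply: eq_bigr => i _; rewrite !mxE.
(* Terms are grouped by the image [A] of [f]. Non-injective [f] contribute 0; if some injective [f0]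
   has image [A], its fibre is the set of all [f0 \o r], [r] a permutation, and the sum over [r]
   rebuilds the minor of [k]. *)
rewrite (partition_big (fun f : {ffun 'I_a -> 'I_b} => [set f i | i : 'I_a]%SET)
  predT) //=.
elim/big_ind: _ => [//|x y Ix Iy|A _]; first by apply: ID; rewrite inE.
case: (pickP [pred f : {ffun 'I_a -> 'I_b} |
    injectiveb f && ([set f i | i : 'I_a]%SET == A)]) => [f0|noinj]; last first.
  rewrite big1 // => f fA; have := noinj f; rewrite /= fA andbT => /negbT.
  move=> /injectivePn[i [j ij fij]].
  rewrite -[\det _]det_tr (determinant_alternate ij) ?mulr0 // => l.
  by rewrite !mxE fij.
move=> /andP[/injectiveP f0_inj /eqP f0A].
pose ext (r : 'S_a) : {ffun 'I_a -> 'I_b} := [ffun i => f0 (r i)].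
have ext_inj : injective ext.
  move=> r t /ffunP rt; apply/permP => i.
  by have := rt i; rewrite !ffunE => /f0_inj.
have fiberE (f : {ffun 'I_a -> 'I_b}) :
    ([set f i | i : 'I_a]%SET == A) = (f \in [set ext r | r : 'S_a]%SET).
  apply/eqP/imsetP => [fA|[r _ ->]]; last first.
    rewrite -f0A; apply/setP => x; apply/imsetP/imsetP => -[i _ ->].
      by exists (r i); rewrite ?ffunE.
    by exists (r^-1%g i); rewrite ?ffunE ?permKV.
  have f_inj : injective f.
    have /imset_injP fi : #|[set f i | i : 'I_a]%SET| == #|'I_a|.
      by rewrite fA -f0A card_imset.
    by move=> i j; apply: fi.
  have /choice[t tE] i : exists j, f0 j = f i.
    have : f i \in A by rewrite -fA imset_f.
    by rewrite -f0A => /imsetP[j _ ->]; exists j.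
  have t_inj : injective t by move=> i j tij; apply: f_inj; rewrite -!tE tij.
  by exists (perm t_inj) => //; apply/ffunP => i; rewrite ffunE permE tE.
rewrite (eq_bigl _ _ fiberE) big_imset /=; last first.
  by move=> r t _ _; exact: ext_inj.
have -> : \sum_(r in 'S_a) (\prod_i k (ext r i) i) * \det (colsub (ext r) h) =
    \det (colsub f0 h) * \det (colsub f0 k^T).
  rewrite big_distrr; apply: eq_big => [r|r _].
    by rewrite inE.
  have -> : colsub (ext r) h = col_perm r (colsub f0 h).
    by apply/matrixP => i j; rewrite !mxE ffunE.
  rewrite col_permE det_mulmx det_perm /= mulrCA; congr (_ * _).
  rewrite mulrC odd_permV; congr (_ * _).
  by apply: eq_bigr => i _; rewrite !mxE ffunE.
rewrite /I; apply: (@sub_span _ R^o).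
exists (\det (colsub f0 h)); first exact: det_colsub_minors.
by exists (\det (colsub f0 k^T)) => //; exact: det_colsub_minors.
Qed.
(** Translates products of ideals of [R] into the monoid law of [fg_submodule]. *)
Lemma emb_prod_set (R : comPzRingType) (S : mulrClosed R) (X Y : set R^o) :
  [set loc_emb S z | z in span [set x * y | x in X & y in Y]] =
  prod_set [set loc_emb S x | x in span X] [set loc_emb S y | y in span Y].
Proof.
rewrite !image_emb_span prod_span; congr span; apply/seteqP; split.
  move=> _ [_ [x Xx [y Yy <-]] <-].
  exists (loc_emb S x); first by exists x.
  by exists (loc_emb S y); [exists y|rewrite rmorphM].
move=> _ [_ [x Xx <-] [_ [y Yy <-] <-]].
by exists (x * y); [exists x => //; exists y|rewrite rmorphM].
Qed.

(** * Multiplicativity and invertibility of Fitting ideals *)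

Lemma minors_ideal_extension (R : comPzRingType) a b c d (A : 'M[R]_(a, b))
    (B : 'M[R]_(c, d)) (C : 'M[R]_(a, d)) k (e : 'M[R]_d) s :
  GRing.lreg s -> k *m B = s *: e ->
  minors_ideal (block_mx A (C *m e) 0 B) = minors_ideal (block_mx A 0 0 B).
Proof.
move=> s_reg kB; congr span.
suff det_eq f : \det (colsub f (block_mx A (C *m e) 0 B)) =
                \det (colsub f (block_mx A 0 0 B)).
  by apply/seteqP; split=> _ [f f_mono <-]; exists f.
(* The corner becomes [s *: (C *m e) - C *m k *m B = 0]. Both left factors have determinant
   [s ^+ a], which multiplies every maximal minor and can be cancelled. *)
have mulE : block_mx s%:M (- (C *m k)) 0 1%:M *m block_mx A (C *m e) 0 B =
    block_mx s%:M 0 0 1%:M *m block_mx A 0 0 B.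
  rewrite !mulmx_block !mul0mx !mulmx0 !mul1mx !addr0 !add0r !mul_scalar_mx.
  by rewrite mulNmx -mulmxA kB -scalemxAr subrr.
have := congr1 (fun H => \det (colsub f H)) mulE.
rewrite /= -!mulmx_colsub !det_mulmx !det_ublock det1 mulr1 det_scalar.
exact: (lregX s_reg).
Qed.

Lemma minors_ideal_castmx (R : comPzRingType) a b a' b' (ea : a = a')
    (eb : b = b') (A : 'M[R]_(a, b)) :
  minors_ideal (castmx (ea, eb) A) = minors_ideal A.
Proof. by case: _ / ea; case: _ / eb. Qed.

Lemma fitting_map_extension (R : comPzRingType) (S : mulrClosed R)
    (noethR : noetherian R) (regS : forall s : R, s \in S -> GRing.lreg s)
    (M' M P : tors_module S) (f : {linear M' -> M}) (g : {linear M -> P}) :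
  proj_dim_le P 1 -> short_exact f g ->
  fitting_map noethR M = (fitting_map noethR P * fitting_map noethR M')%g.
Proof.
move=> pdP fg; apply: fg_submodule_eq => /=.
have [p _] := noetherian_presentation noethR (tors_fin_gen P).
have [p' _] := noetherian_presentation noethR (tors_fin_gen M').
have [s [k [e [sS hk kh he]]]] := pd1_cofactor p pdP.
have [C [q [eg [er qE]]]] := presentation_extension p' fg he.
rewrite (fitting_idealE _ p) (fitting_idealE _ p') (fitting_idealE _ q).
rewrite -(minors_ideal_castmx eg er) qE.
rewrite (minors_ideal_extension _ _ (regS _ sS) kh) minors_ideal_diag.
exact: emb_prod_set.
Qed.

Lemma fitting_map_unit (R : comPzRingType) (S : mulrClosed R)
    (noethR : noetherian R) (P : tors_module S) :
  proj_dim_le P 1 -> exists omega : fg_submodule S,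
    (fitting_map noethR P * omega = 1)%g.
Proof.
move=> pdP.
have [p _] := noetherian_presentation noethR (tors_fin_gen P).
have [s [k [e [sS hk kh he]]]] := pd1_cofactor p pdP.
have [u su] := Localization.emb_denom_inv sS.
set h := pres_mx p in hk kh he; set a := pres_gens p in k h hk kh he *.
(* [u] is the inverse of [s], and [k] is transposed so that its maximal minors select rows; [J]
   generates the inverse of Fitt(P). *)
pose J := [set u ^+ a * loc_emb S y | y in minors k^T].
have J_fin : finite_set J by exact/finite_image/finite_minors.
exists (FgSubmodule (@span_submodule _ _ J) (ex_intro2 _ _ J J_fin erefl)).
apply: fg_submodule_eq => /=.
rewrite (fitting_idealE _ p) image_emb_span prod_span.
have su_a : loc_emb S (s ^+ a) * u ^+ a = 1.
  by rewrite rmorphXn -exprMn su expr1n.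
apply/seteqP; split; apply: span_sub; try exact: span_submodule.
  move=> _ [_ [_ [f _ <-] <-] [_ [_ [g _ <-] <-] <-]].
  have -> : loc_emb S (\det (colsub f h)) *
        (u ^+ a * loc_emb S (\det (colsub g k^T)))
      = \det (mxsub g f e) *: (1 : localization S).
    rewrite mulrCA -rmorphM mulrC.
    (* The product is the minor of [k *m h = s *: e] on rows [g] and columns [f]. *)
    have -> : \det (colsub f h) * \det (colsub g k^T) =
        \det (mxsub g f e) * s ^+ a.
      rewrite mulrC -det_tr -det_mulmx mulrC -detZ.
      congr (\det _); apply/matrixP => i j.
      have /matrixP/(_ (g i) (f j)) := kh; rewrite !mxE => <-.
      by apply: eq_bigr => l _; rewrite !mxE.
    by rewrite rmorphM -mulrA su_a.
  have /submoduleP[I0 Il] := @span_submodule _ (localization S) [set 1].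
  by rewrite -[_ *: _]addr0; apply: Il => //; exact: sub_span.
move=> _ ->.
have : [set loc_emb S x | x in span
     ([set x * y | x in minors_ideal h & y in minors_ideal k^T] : set R^o)]
    (loc_emb S (s ^+ a)).
  rewrite -det_scalar -hk; exists (\det (h *m k)) => //.
  exact: det_mul_minors_prod.
rewrite emb_prod_set !span_id ?image_emb_span ?prod_span;
  try exact: span_submodule.
set T := prod_set _ J => st.
(* Since [1 = u ^+ a * s ^+ a], it suffices that [T'] contains [s ^+ a]. Being a submodule, [T']
   need only contain the generators of the product in which Cauchy-Binet places [s ^+ a]. *)
pose T' := [set x : localization S | T (u ^+ a * x)].
rewrite -su_a mulrC; change (T' (loc_emb S (s ^+ a))).
move: st; apply: span_sub.
  have /submoduleP[T0 Tl] : submodule T by exact: span_submodule.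
  apply/submoduleP; rewrite /T' /= mulr0; split=> // c x y Tx Ty.
  by rewrite mulrDr -loc_scaleAr; exact: Tl.
move=> _ [x Xx [_ [y Yy <-] <-]]; apply: sub_span.
by exists x => //; exists (u ^+ a * loc_emb S y); [exists y|rewrite mulrCA].
Qed.

Theorem proposition2p7 (R : comPzRingType) (S : mulrClosed R)
    (noethR : noetherian R)
    (regS : forall s : R, s \in S -> GRing.lreg s) :
  fitting_invariant (@fitting_map R S noethR).
Proof.
split=> [P|M' M P f g]; first exact: fitting_map_unit.
exact: fitting_map_extension.
Qed.
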